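(* Let $G=(V,E,w)$ be a finite graph with edge weights $w\in\mathbb{R}_+^E$, let $f:\mathbb{R}^V\to\mathbb{R}$ be differentiable, for each $v\in V$ let $g_v:\mathbb{R}\to\,]-\infty,+\infty]$ be directionally differentiable, and let $$F:\mathbb{R}^V\to\,]-\infty,+\infty],\qquad F(x)=f(x)+\sum_{v\in V}g_v(x_v)+\sum_{(u,v)\in E}w_{(u,v)}|x_u-x_v| .$$ Let $x\in\operatorname{dom}F$. Then the steepest ternary direction problem $$\text{find}\quad d^{(x)}\in\operatorname*{arg\,min}_{d\in\{-1,0,+1\}^V}F'(x,d)$$ can be solved by finding a minimum cut in the flow graph $G^{(x)}_{\mathrm{flow}}$ (defined in the context).
   Context: Directional derivatives. For a real vector space $\Omega$ and $h:\Omega\to\,]-\infty,+\infty]$, $\operatorname{dom}h=\{x\in\Omega\mid h(x)<+\infty\}$. For $x\in\operatorname{dom}h$ and $d\in\Omega$, $h$ admits a directional derivative at point $x$ in direction $d$ if $h'(x,d)=\lim_{t\downarrow0}\frac{h(x+td)-h(x)}{t}$ exists in $]-\infty,+\infty]$. The function $h$ is directionally differentiable if it admits a directional derivative at every point of its domain and in every direction. Under the hypotheses of the claim, $F$ admits a directional derivative $F'(x,d)$ at every $x\in\operatorname{dom}F$ in every direction $d\in\mathbb{R}^V$. Let $\operatorname{sign}:\mathbb{R}\to\{-1,0,+1\}$ be $-1$ on negative numbers, $0$ at $0$, $+1$ on positive numbers. Let $E^{(x)}_{=}=\{(u,v)\in E\mid x_u=x_v\}$. For $v\in V$, with $\nabla_vf(x)$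 the partial derivative of $f$ at $x$ with respect to coordinate $v$, set $$\delta_v^+(x)=\nabla_vf(x)+g_v'(x_v,+1)+\sum_{\substack{(e,u)\in E\times V\\ e=(u,v)\text{ or }(v,u)}}w_e\operatorname{sign}(x_v-x_u),$$ $$\delta_v^-(x)=\nabla_vf(x)-g_v'(x_v,-1)+\sum_{\substack{(e,u)\in E\times V\\ e=(u,v)\text{ or }(v,u)}}w_e\operatorname{sign}(x_v-x_u).$$ The definition of directional derivatives implies $\delta_v^-(x)<+\infty$ and $-\delta_v^+(x)<+\infty$. Flow graph $G^{(x)}_{\mathrm{flow}}=(V_{\mathrm{flow}},E^{(x)}_{\mathrm{flow}},c^{(x)})$. The vertex set is $V_{\mathrm{flow}}=(V\times\{1,2\})\cup\{s,t\}$, where $s$ and $t$ are respectively the specific source and sink vertices, and $v^{(k)}$ denotes $(v,k)\in V\times\{1,2\}$. The edge set is $$E^{(x)}_{\mathrm{flow}}=\bigcup_{v\in V}\{(s,v^{(1)}),(v^{(1)},v^{(2)}),(v^{(2)},t)\}\ \cup\bigcup_{\substack{(u,v)\in E^{(x)}_{=}\\k\in\{1,2\}}}\{(u^{(k)},v^{(k)}),(v^{(k)},u^{(k)})\}.$$ The edges in the left union are called vertical, those in the right union horizontal. The capacities $c^{(x)}$ are nonnegative, although potentially infinite, and are defined as follows. Horizontal edges: for all $(u,v)\in E^{(x)}_{=}$ and $k\in\{1,2\}$, $c^{(x)}_{(u^{(k)},v^{(k)})}=c^{(x)}_{(v^{(k)},u^{(k)})}=w_{(u,v)}$. Vertical edges: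 for all $v\in V$, with $m_v=\max(0,\delta_v^-(x),-\delta_v^+(x))$, $$c^{(x)}_{(s,v^{(1)})}=-\delta_v^-(x)+m_v,\qquad c^{(x)}_{(v^{(1)},v^{(2)})}=m_v,\qquad c^{(x)}_{(v^{(2)},t)}=\delta_v^+(x)+m_v .$$ A cut is an ordered partition $(S,T)$ of $V_{\mathrm{flow}}$ such that $s\in S$ and $t\in T$; its value is $\operatorname{cut}(S,T)=\sum_{(a,b)\in E^{(x)}_{\mathrm{flow}}\cap(S\times T)}c^{(x)}_{(a,b)}$. A minimum cut is a cut of minimum value. *)

(* Defs.v *)
From HB Require Import structures.
From mathcomp Require Import all_boot all_order all_algebra.
From mathcomp Require Import all_classical all_reals all_analysis.
Import Order.TTheory GRing.Theory Num.Theory.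
Import numFieldNormedType.Exports.

Set Implicit Arguments.
Unset Strict Implicit.
Unset Printing Implicit Defensive.

Local Open Scope ring_scope.

(* The target ]-oo, +oo] of an extended-valued function h is expressed by
   [\bar R] together with the hypothesis [forall x, h x != -oo]. *)

Definition edom (R : realType) (X : lmodType R) (h : X -> \bar R) (x : X) : Prop :=
  (h x < +oo)%E.

Definition diff_quotient (R : realType) (X : lmodType R) (h : X -> \bar R)
    (x d : X) (t : R) : \bar R :=
  ((h (x + t *: d)%R - h x) * (t^-1)%:E)%E.

Definition admits_dirder (R : realType) (X : lmodType R) (h : X -> \bar R)
    (x d : X) : Prop :=
  exists2 l : \bar R, l != -oo%E &
    (diff_quotient h x d t @[t --> 0^'+] --> l)%classic.

(* [lim] is total: this is h'(x, d) only when [admits_dirder h x d]. *)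
Definition dirder (R : realType) (X : lmodType R) (h : X -> \bar R)
    (x d : X) : \bar R :=
  lim (diff_quotient h x d t @[t --> 0^'+])%classic.

Definition directionally_differentiable (R : realType) (X : lmodType R)
    (h : X -> \bar R) : Prop :=
  forall x d : X, edom h x -> admits_dirder h x d.

(* R^V, for V a finite type, is the normed space of row vectors of length #|V|,
   the coordinates being indexed by V through [enum_rank]. *)
Definition vcoord (R : realType) (V : finType) (x : 'rV[R]_#|V|) (v : V) : R :=
  x ord0 (enum_rank v).

Definition vec (R : realType) (V : finType) (a : V -> R) : 'rV[R]_#|V| :=
  \row_i a (enum_val i).

Definition partial_der (R : realType) (V : finType) (f : 'rV[R]_#|V| -> R)
    (v : V) (x : 'rV[R]_#|V|) : R :=
  'D_(delta_mx ord0 (enum_rank v)) f x.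

(* A graph on V is given by E : {set V * V}, each edge being listed under one
   orientation.  If (u, v) and (v, u) could both be edges, with u != v, the
   capacity of the flow edge (u^(k), v^(k)) would have two competing values. *)
Definition oriented_once (V : finType) (E : {set V * V}) : Prop :=
  forall u v : V, (u, v) \in E -> (v, u) \in E -> u = v.

Definition objective (R : realType) (V : finType) (E : {set V * V})
    (w : V * V -> R) (f : 'rV[R]_#|V| -> R) (g : V -> R -> \bar R)
    (x : 'rV[R]_#|V|) : \bar R :=
  ((f x)%:E + \sum_(v : V) g v (vcoord x v)
   + (\sum_(e in E) w e * `|vcoord x e.1 - vcoord x e.2|)%:E)%E.

Definition tied_edges (R : realType) (V : finType) (E : {set V * V})
    (x : 'rV[R]_#|V|) : {set V * V} :=
  [set e in E | vcoord x e.1 == vcoord x e.2].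

(* The index p stands for the pair (e, u) in E * V. *)
Definition sign_sum (R : realType) (V : finType) (E : {set V * V})
    (w : V * V -> R) (x : 'rV[R]_#|V|) (v : V) : R :=
  \sum_(p : (V * V) * V |
          (p.1 \in E) && ((p.1 == (p.2, v)) || (p.1 == (v, p.2))))
    w p.1 * Num.sg (vcoord x v - vcoord x p.2).

Definition delta_plus (R : realType) (V : finType) (E : {set V * V})
    (w : V * V -> R) (f : 'rV[R]_#|V| -> R) (g : V -> R -> \bar R)
    (x : 'rV[R]_#|V|) (v : V) : \bar R :=
  ((partial_der f v x)%:E + dirder (g v) (vcoord x v) 1
   + (sign_sum E w x v)%:E)%E.

Definition delta_minus (R : realType) (V : finType) (E : {set V * V})
    (w : V * V -> R) (f : 'rV[R]_#|V| -> R) (g : V -> R -> \bar R)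
    (x : 'rV[R]_#|V|) (v : V) : \bar R :=
  ((partial_der f v x)%:E - dirder (g v) (vcoord x v) (-1)
   + (sign_sum E w x v)%:E)%E.

Definition middle_capacity (R : realType) (V : finType) (E : {set V * V})
    (w : V * V -> R) (f : 'rV[R]_#|V| -> R) (g : V -> R -> \bar R)
    (x : 'rV[R]_#|V|) (v : V) : \bar R :=
  Order.max 0%E
    (Order.max (delta_minus E w f g x v) (- delta_plus E w f g x v)%E).

(* In V * bool, the booleans false and true stand for the layers 1 and 2. *)
Definition flow_vertex (V : finType) : finType := ((V * bool) + bool)%type.

Definition layered (V : finType) (k : bool) (v : V) : flow_vertex V := inl (v, k).
Definition copy1 (V : finType) (v : V) : flow_vertex V := layered false v.
Definition copy2 (V : finType) (v : V) : flow_vertex V := layered true v.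
Definition source (V : finType) : flow_vertex V := inr false.
Definition sink (V : finType) : flow_vertex V := inr true.

Definition flow_edges (R : realType) (V : finType) (E : {set V * V})
    (x : 'rV[R]_#|V|) : {set flow_vertex V * flow_vertex V} :=
  (\bigcup_(v : V) [set (source V, copy1 v); (copy1 v, copy2 v); (copy2 v, sink V)])
  :|: (\bigcup_(e in tied_edges E x) \bigcup_(k : bool)
         [set (layered k e.1, layered k e.2); (layered k e.2, layered k e.1)]).

(* Only the values on [flow_edges E x] are meaningful.  There, an edge between
   different layers is some (v^(1), v^(2)), and an edge inside a layer is
   (u^(k), v^(k)) with (u, v) or (v, u) tied. *)
Definition capacity (R : realType) (V : finType) (E : {set V * V})
    (w : V * V -> R) (f : 'rV[R]_#|V| -> R) (g : V -> R -> \bar R)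
    (x : 'rV[R]_#|V|) (p : flow_vertex V * flow_vertex V) : \bar R :=
  match p with
  | (inr false, inl (v, false)) =>
      (- delta_minus E w f g x v + middle_capacity E w f g x v)%E
  | (inl (v, true), inr true) =>
      (delta_plus E w f g x v + middle_capacity E w f g x v)%E
  | (inl (u, k), inl (v, l)) =>
      if k == l then (w (if (u, v) \in tied_edges E x then (u, v) else (v, u)))%:E
      else middle_capacity E w f g x v
  | _ => 0%E
  end.

Definition is_cut (V : finType) (S T : {set flow_vertex V}) : Prop :=
  [/\ S :|: T = [set: flow_vertex V], S :&: T = finset.set0,
      source V \in S & sink V \in T].

Definition cut_value (R : realType) (V : finType) (E : {set V * V})
    (w : V * V -> R) (f : 'rV[R]_#|V| -> R) (g : V -> R -> \bar R)
    (x : 'rV[R]_#|V|) (S T : {set flow_vertex V}) : \bar R :=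
  (\sum_(p in flow_edges E x :&: finset.setX S T) capacity E w f g x p)%E.

Definition is_min_cut (R : realType) (V : finType) (E : {set V * V})
    (w : V * V -> R) (f : 'rV[R]_#|V| -> R) (g : V -> R -> \bar R)
    (x : 'rV[R]_#|V|) (S T : {set flow_vertex V}) : Prop :=
  is_cut S T /\
  forall S' T' : {set flow_vertex V}, is_cut S' T' ->
    (cut_value E w f g x S T <= cut_value E w f g x S' T')%E.

Definition ternary (R : realType) (V : finType) (d : 'rV[R]_#|V|) : Prop :=
  forall v : V, vcoord d v \in [:: -1; 0; 1].

Definition steepest_ternary_direction (R : realType) (V : finType)
    (h : 'rV[R]_#|V| -> \bar R) (x d : 'rV[R]_#|V|) : Prop :=
  ternary d /\
  forall d' : 'rV[R]_#|V|, ternary d' -> (dirder h x d <= dirder h x d')%E.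

(* The ternary direction read off a cut (S, T): it is +1, 0 or -1 at v according
   as S contains both v^(1) and v^(2), only v^(1), or none of them.  For such v
   the vertical edge that is cut is (v^(2), t), (v^(1), v^(2)) or (s, v^(1)).
   A nonconvex g_v may give delta_v^+ < delta_v^-, and then a minimum cut may
   also put v^(2) alone in S.  Reading 0 there would be wrong; the value +1 is
   taken for all such v. *)
Definition cut_direction (R : realType) (V : finType) (S : {set flow_vertex V}) :
    'rV[R]_#|V| :=
  vec (fun v : V =>
         if copy2 v \in S then 1 else if copy1 v \in S then 0 else -1).

(* Main.v *)
Require Import Defs.
From HB Require Import structures.
From mathcomp Require Import all_boot all_order all_algebra.
From mathcomp Require Import all_classical all_reals all_analysis.
From mathcomp Require Import ring lra.
Import Order.TTheory GRing.Theory Num.Theory.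
Import numFieldNormedType.Exports.

(* Writing A and B for the sets of v whose copies 1 and 2 lie in S, a cut costs
   a sum over v of vertical capacities plus the horizontal cut functions of A and
   B.  When B is contained in A, the direction d = 1_A + 1_B - 1 is ternary, every
   ternary direction arises in this way, and the cost is F'(x, d) plus the
   constant sum of the middle capacities: a tied edge contributes
   w |d_u - d_v| = w |1_A u - 1_A v| + w |1_B u - 1_B v|, and the untied edges are
   linear in d, hence absorbed in the delta_v.  If B is not contained in A, the
   submodularity of the horizontal cut functions gives
   cut (A u B, B) + cut (A, A n B) <= 2 cut (A, B), so that (A u B, B), which
   has the same cut direction, is a minimum cut whenever (A, B) is one. *)

Set Implicit Arguments.
Unset Strict Implicit.
Unset Printing Implicit Defensive.

Local Open Scope ring_scope.

(** * Calculus of directional derivatives *)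

(** Existence and value are kept together, because [dirder] is a total [lim]. The bound [l != -oo]
    makes sums of such limits defined. *)
Definition has_dirder (R : realType) (X : lmodType R) (h : X -> \bar R)
    (x d : X) (l : \bar R) : Prop :=
  l != -oo%E /\ (diff_quotient h x d t @[t --> 0^'+] --> l)%classic.

Lemma admits_dirderP (R : realType) (X : lmodType R) (h : X -> \bar R) (x d : X) :
  admits_dirder h x d <-> exists l, has_dirder h x d l.
Proof. by split=> [[l lNy hl]|[l [lNy hl]]]; exists l. Qed.

Lemma has_dirder_dirder (R : realType) (X : lmodType R) (h : X -> \bar R)
    (x d : X) (l : \bar R) : has_dirder h x d l -> dirder h x d = l.
Proof. by move=> [_ hl]; apply: cvg_lim hl; exact: ereal_hausdorff. Qed.

(** Finiteness is required only at [x]: the values at [x + t *: d] may be +oo. With -oo excluded no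
    sum is of the form +oo - oo, so multiplication by the finite [t^-1] distributes. *)
Lemma diff_quotientD (R : realType) (X : lmodType R) (h k : X -> \bar R)
    (x d : X) (t : R) :
  (forall y, h y != -oo%E) -> (forall y, k y != -oo%E) ->
  h x \is a fin_num -> k x \is a fin_num ->
  diff_quotient (fun y => h y + k y)%E x d t =
  (diff_quotient h x d t + diff_quotient k x d t)%E.
Proof.
move=> hNy kNy; rewrite /diff_quotient.
have := hNy (x + t *: d); have := kNy (x + t *: d).
case: (h x) (k x) => [a| |] [b| |] //.
case: (h _) (k _) => [p| |] [q| |] //= _ _ _ _.
- by rewrite -!EFinB -!EFinM -EFinD; congr EFin; rewrite -mulrDl opprD addrACA.
- by rewrite -muleDl.
- by rewrite -muleDl.
- by rewrite -muleDl.
Qed.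

Lemma has_dirderD (R : realType) (X : lmodType R) (h k : X -> \bar R)
    (x d : X) (l m : \bar R) :
  (forall y, h y != -oo%E) -> (forall y, k y != -oo%E) ->
  h x \is a fin_num -> k x \is a fin_num ->
  has_dirder h x d l -> has_dirder k x d m ->
  has_dirder (fun y => h y + k y)%E x d (l + m)%E.
Proof.
move=> hNy kNy hx kx [lNy hl] [mNy km]; split.
  by rewrite adde_eq_ninfty negb_or lNy.
under eq_fun do rewrite diff_quotientD//.
by apply: cvgeD => //; apply: ltninfty_adde_def; rewrite inE ltNye.
Qed.

Lemma has_dirder0 (R : realType) (X : lmodType R) (x d : X) :
  has_dirder (fun=> 0%E : \bar R) x d 0%E.
Proof.
split=> //; rewrite /diff_quotient; under eq_fun do rewrite sube0 mul0e.
exact: cvg_cst.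
Qed.

Lemma has_dirder_sum (R : realType) (X : lmodType R) (I : eqType) (s : seq I)
    (P : pred I) (h : I -> X -> \bar R) (x d : X) (l : I -> \bar R) :
  (forall i y, P i -> h i y != -oo%E) ->
  (forall i, P i -> h i x \is a fin_num) ->
  (forall i, P i -> has_dirder (h i) x d (l i)) ->
  has_dirder (fun y => \sum_(i <- s | P i) h i y)%E x d
    (\sum_(i <- s | P i) l i)%E.
Proof.
move=> hNy hx hl; elim: s => [|i s IHs].
  by under eq_fun do rewrite big_nil; rewrite big_nil; exact: has_dirder0.
under eq_fun do rewrite big_cons; rewrite big_cons; case: ifP => // Pi.
apply: has_dirderD; rewrite ?hx ?hl//.
- by move=> y; exact: hNy.
- by move=> y; apply/eqP => /esum_eqNyP[j [_ Pj /eqP]]; apply/negP/hNy.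
- by apply/sum_fin_numP => j _; exact: hx.
- exact: hl.
Qed.

Lemma has_dirder_EFin (R : realType) (X : lmodType R) (h : X -> R) (x d : X) (l : R) :
  ((h (x + t *: d) - h x) / t @[t --> 0^'+] --> l)%classic ->
  has_dirder (fun y => (h y)%:E) x d l%:E.
Proof.
by move=> hl; split=> //; rewrite /diff_quotient; apply: cvg_EFin; first exact: nearW.
Qed.

Lemma has_dirder_vcoord (R : realType) (V : finType) (h : R -> \bar R) (v : V)
    (x d : 'rV[R]_#|V|) (l : \bar R) :
  has_dirder h (vcoord x v) (vcoord d v) l ->
  has_dirder (fun y => h (vcoord y v)) x d l.
Proof.
move=> [lNy hl]; split=> //; move: hl.
by rewrite /diff_quotient /vcoord; under [in X in _ -> X]eq_fun do rewrite !mxE.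
Qed.

Lemma has_dirder_differentiable (R : realType) (n : nat) (f : 'rV[R]_n -> R)
    (x d : 'rV[R]_n) :
  differentiable f x -> has_dirder (fun y => (f y)%:E) x d ('D_d f x)%:E.
Proof.
move=> fx; apply: has_dirder_EFin.
have /cvg_dnbhs_at_right := @diff_derivable _ _ _ f x d fx.
rewrite -/('D_d f x); under eq_fun do rewrite /= [_ *: d + x]addrC [_ *: _]mulrC.
exact.
Qed.

Lemma derive_partial (R : realType) (V : finType) (f : 'rV[R]_#|V| -> R)
    (x d : 'rV[R]_#|V|) :
  differentiable f x ->
  'D_d f x = \sum_v vcoord d v * partial_der f v x.
Proof.
move=> fx; rewrite deriveE// {1}(row_sum_delta d) linear_sum.
rewrite (reindex _ (onW_bij _ (@enum_rank_bij V))).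
by apply: eq_bigr => v _; rewrite linearZ /= /partial_der deriveE.
Qed.

Definition norm_dirder (R : realType) (a b : R) : R :=
  if a == 0 then `|b| else Num.sg a * b.

(** The quotient is constant for small t > 0: at a = 0 by homogeneity, otherwise because a + t b
    keeps the sign of a as long as t |b| < |a|. *)
Lemma norm_diff_quotient (R : realType) (a b : R) :
  ((`|a + t * b| - `|a|) / t @[t --> 0^'+] --> norm_dirder a b)%classic.
Proof.
apply: cvg_near_cst; rewrite /norm_dirder.
have [->|a0] := eqVneq a 0.
  near=> t; have t0 : 0 < t by near: t; exact: nbhs_right_gt.
  by rewrite add0r normr0 subr0 normrM (gtr0_norm t0) mulrC mulKf// gt_eqF.
near=> t; have t0 : 0 < t by near: t; exact: nbhs_right_gt.
have tb : `|t * b| < `|a|.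
  (* The + 1 keeps the denominator positive when b = 0. *)
  have : t < `|a| / (`|b| + 1).
    by near: t; apply: nbhs_right_lt; rewrite divr_gt0 ?normr_gt0// ltr_wpDl.
  rewrite ltr_pdivlMr ?ltr_wpDl// => /le_lt_trans; apply.
  by rewrite normrM (gtr0_norm t0) ler_wpM2l ?(ltW t0)// lerDl.
suff -> : `|a + t * b| = `|a| + t * (Num.sg a * b).
  by rewrite addrAC subrr add0r mulrC mulKf// gt_eqF.
have [a_gt0|a_lt0|/eqP] := ltrgt0P a; last by rewrite (negPf a0).
- rewrite gtr0_sg// mul1r ger0_norm//; move: tb; rewrite (gtr0_norm a_gt0).
  rewrite ltr_norml => /andP[+ _]; rewrite -subr_gt0 opprK addrC; exact: ltW.
- rewrite ltr0_sg// mulN1r ler0_norm; first by rewrite mulrN opprD.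
  move: tb; rewrite (ltr0_norm a_lt0) ltr_norml => /andP[_].
  by rewrite -subr_gt0 -opprD oppr_gt0 => /ltW.
Unshelve. all: by end_near. Qed.

Lemma has_dirder_distance (R : realType) (V : finType) (c : R) (u v : V)
    (x d : 'rV[R]_#|V|) :
  has_dirder (fun y => (c * `|vcoord y u - vcoord y v|)%:E) x d
    (c * norm_dirder (vcoord x u - vcoord x v) (vcoord d u - vcoord d v))%:E.
Proof.
apply: has_dirder_EFin.
have := cvgMl_tmp (a := c) (@norm_diff_quotient R (vcoord x u - vcoord x v) (vcoord d u - vcoord d v)).
rewrite /vcoord => hl; under eq_fun do
  rewrite !mxE opprD addrACA -mulrBr -mulrBr -mulrA.
exact: hl.
Qed.

(** * Directional derivative of the objective *)

Lemma edom_objective (R : realType) (V : finType) (E : {set V * V})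
    (w : V * V -> R) (f : 'rV[R]_#|V| -> R) (g : V -> R -> \bar R)
    (x : 'rV[R]_#|V|) :
  (forall (v : V) (y : R), g v y != -oo%E) ->
  edom (objective E w f g) x -> forall v, g v (vcoord x v) \is a fin_num.
Proof.
move=> gNy; rewrite /edom /objective => + v.
rewrite fin_numE gNy /=; apply: contraTN => /eqP gy.
rewrite (_ : (\sum_(_ : V) _)%E = +oo%E)//.
by apply/eqP; rewrite esum_eqy//; apply/existsP; exists v; apply/eqP.
Qed.

Lemma has_dirder_objective (R : realType) (V : finType) (E : {set V * V})
    (w : V * V -> R) (f : 'rV[R]_#|V| -> R) (g : V -> R -> \bar R)
    (x d : 'rV[R]_#|V|) :
  differentiable f x ->
  (forall (v : V) (y : R), g v y != -oo%E) ->
  (forall v : V, directionally_differentiable (g v)) ->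
  edom (objective E w f g) x ->
  has_dirder (objective E w f g) x d
    (('D_d f x)%:E + \sum_v dirder (g v) (vcoord x v) (vcoord d v)
     + (\sum_(e in E) w e * norm_dirder (vcoord x e.1 - vcoord x e.2)
                                        (vcoord d e.1 - vcoord d e.2))%:E)%E.
Proof.
move=> fx gNy gdir /(edom_objective gNy) gx; rewrite /objective.
have sumNy y : (\sum_v g v (vcoord y v) != -oo)%E.
  by apply/eqP => /esum_eqNyP[v [_ _ /eqP]]; apply/negP.
have sumfin : (\sum_v g v (vcoord x v))%E \is a fin_num by apply/sum_fin_numP.
apply: has_dirderD => //.
- by move=> y; rewrite adde_eq_ninfty negb_or sumNy.
- by rewrite fin_numD sumfin.
- apply: has_dirderD => //; first exact: has_dirder_differentiable.
  apply: has_dirder_sum => // v _; apply: has_dirder_vcoord.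
  have /admits_dirderP[l hl] : admits_dirder (g v) (vcoord x v) (vcoord d v).
    by apply: gdir; rewrite /edom ltey_eq gx.
  by rewrite (has_dirder_dirder hl).
- rewrite -sumEFin; under eq_fun do rewrite -sumEFin.
  by apply: has_dirder_sum => // e _; exact: has_dirder_distance.
Qed.

(** An edge is met once from each of its endpoints. A loop is met only once, since both disjuncts
    then select the same pair; vanishing of [G] on the diagonal makes the formula cover it too. *)
Lemma sum_incident_pairs (R : nmodType) (V : finType) (G : V -> V -> R) (e : V * V) :
  (forall v, G v v = 0) ->
  \sum_v \sum_(u | (e == (u, v)) || (e == (v, u))) G v u = G e.1 e.2 + G e.2 e.1.
Proof.
case: e => a b G0 /=.
transitivity (\sum_v (\sum_(u | (a, b) == (v, u)) G v u
                      + \sum_(u | (a, b) == (u, v)) G v u)).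
  apply: eq_bigr => v _; rewrite big_mkcond [X in _ = X + _]big_mkcond.
  rewrite [X in _ = _ + X]big_mkcond -big_split /=; apply: eq_bigr => u _.
  rewrite !xpair_eqE; have [<-|uv] := eqVneq u v.
    by rewrite G0 !if_same addr0.
  have [->|_] := eqVneq a u; last by rewrite addr0.
  by rewrite (negPf uv) /= orbF add0r.
rewrite big_split /= !pair_big_dep /=; congr (_ + _).
  by rewrite (big_pred1 (a, b)) // => -[v u] /=; rewrite eq_sym.
rewrite (big_pred1 (b, a)) // => -[v u] /=.
by rewrite !xpair_eqE andbC (eq_sym v) (eq_sym u).
Qed.

(** The sign sum may run over all edges, since a tied edge has sign 0 there. Oddness of the sign
    merges the contributions of the two endpoints of an edge into one multiple of d_u - d_v. *)
Lemma sum_norm_dirder (R : realType) (V : finType) (E : {set V * V})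
    (w : V * V -> R) (x d : 'rV[R]_#|V|) :
  \sum_(e in E) w e * norm_dirder (vcoord x e.1 - vcoord x e.2)
                                  (vcoord d e.1 - vcoord d e.2) =
  \sum_v vcoord d v * sign_sum E w x v
  + \sum_(e in tied_edges E x) w e * `|vcoord d e.1 - vcoord d e.2|.
Proof.
have -> : \sum_v vcoord d v * sign_sum E w x v =
    \sum_(e in E) w e * (Num.sg (vcoord x e.1 - vcoord x e.2)
                         * (vcoord d e.1 - vcoord d e.2)).
  transitivity (\sum_v \sum_(e in E) \sum_(u | (e == (u, v)) || (e == (v, u)))
      vcoord d v * (w e * Num.sg (vcoord x v - vcoord x u))).
    by apply: eq_bigr => v _; rewrite mulr_sumr pair_big_dep.
  rewrite exchange_big /=; apply: eq_bigr => e _.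
  rewrite sum_incident_pairs => [|v]; last by rewrite subrr sgr0 !mulr0.
  by rewrite -(opprB (vcoord x e.1) (vcoord x e.2)) sgrN; ring.
rewrite [X in _ = _ + X](eq_bigl (fun e => (e \in E) && (vcoord x e.1 == vcoord x e.2))); last first.
  by move=> e; rewrite !inE.
rewrite [X in _ = _ + X]big_mkcondr /= -big_split /=; apply: eq_bigr => e _.
rewrite /norm_dirder subr_eq0; case: eqP => [->|_]; last by rewrite addr0.
by rewrite subrr sgr0 mul0r mulr0 add0r.
Qed.

(** * The value of a cut in terms of its two layers *)

Lemma sum_flow_vertex (R : realType) (V : finType) (F : flow_vertex V -> \bar R) :
  (\sum_a F a = \sum_v (F (copy1 v) + F (copy2 v)) + (F (source V) + F (sink V)))%E.
Proof.
rewrite big_sumType /= big_bool [X in (_ + X)%E]addeC; congr (_ + _)%E.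
transitivity (\sum_(v : V) \sum_(k : bool) F (layered k v))%E.
  by rewrite pair_bigA /=; apply: eq_bigr => -[].
by apply: eq_bigr => v _; rewrite big_bool addeC.
Qed.

(** A case table, so that membership reduces by computation once the kinds of the two endpoints are
    known. *)
Lemma mem_flow_edges (R : realType) (V : finType) (E : {set V * V})
    (x : 'rV[R]_#|V|) (a b : flow_vertex V) :
  ((a, b) \in flow_edges E x) =
  match a, b with
  | inr false, inl (_, false) => true
  | inl (_, true), inr true => true
  | inl (u, k), inl (v, l) =>
      (k == l) && (((u, v) \in tied_edges E x) || ((v, u) \in tied_edges E x))
      || [&& ~~ k, l & u == v]
  | _, _ => false
  end.
Proof.
rewrite /flow_edges finset.in_setU; apply/orP/idP => [[]|].
- by case/finset.bigcupP => v _; rewrite !inE => /orP[/orP[]|] /eqP[-> ->] //=; rewrite eqxx.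
- case/finset.bigcupP => -[u v] uv /finset.bigcupP[k _]; rewrite !inE /= => /orP[] /eqP[-> ->] /=;
    by rewrite if_same eqxx uv ?orbT.
have horizontal k u v : ((u, v) \in tied_edges E x) || ((v, u) \in tied_edges E x) ->
    (layered k u, layered k v) \in \bigcup_(e in tied_edges E x) \bigcup_(k : bool)
      [set (layered k e.1, layered k e.2); (layered k e.2, layered k e.1)].
  by case/orP => uv; apply/finset.bigcupP; [exists (u, v)|exists (v, u)] => //;
    apply/finset.bigcupP; exists k; rewrite // !inE eqxx ?orbT.
case: a b => [[u [|]]|[]] [[v [|]]|[]] //=; rewrite ?orbF ?andbF.
- by right; exact: (horizontal true).
- by left; apply/finset.bigcupP; exists u => //; rewrite !inE eqxx orbT.
- by move=> /eqP <-; left; apply/finset.bigcupP; exists u => //; rewrite !inE eqxx orbT.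
- by right; exact: (horizontal false).
- by left; apply/finset.bigcupP; exists v => //; rewrite !inE eqxx.
Qed.

Definition horizontal_cut (R : realType) (V : finType) (E : {set V * V})
    (w : V * V -> R) (x : 'rV[R]_#|V|) (A : pred V) : R :=
  \sum_(e in tied_edges E x) w e * (A e.1 != A e.2)%:R.

(** A tied edge occurs in the flow graph in both directions, and exactly one of them leaves [A] when
    its endpoints are separated. [oriented_once] makes the weight chosen by the [if] that of the
    only edge of [E] between them. *)
Lemma sum_horizontal_edges (R : realType) (V : finType) (E : {set V * V})
    (w : V * V -> R) (x : 'rV[R]_#|V|) (A : pred V) :
  oriented_once E ->
  \sum_u \sum_v
    (if (((u, v) \in tied_edges E x) || ((v, u) \in tied_edges E x)) && (A u && ~~ A v)
     then w (if (u, v) \in tied_edges E x then (u, v) else (v, u)) else 0) =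
  horizontal_cut E w x A.
Proof.
(* Here [q] is the flow edge that is crossed and [p] is the edge of [E] giving its weight, either
   [q] or its reversal. *)
move=> Eor; pose half (p q : V * V) :=
  if (p \in tied_edges E x) && (A q.1 && ~~ A q.2) then w p else 0.
transitivity (\sum_u \sum_v (half (u, v) (u, v) + half (v, u) (u, v))).
  apply: eq_bigr => u _; apply: eq_bigr => v _; rewrite /half /=.
  have [/andP[Au Av]|_] := boolP (A u && ~~ A v); last by rewrite !andbF /= addr0.
  have notboth : ~ [/\ (u, v) \in tied_edges E x & (v, u) \in tied_edges E x].
    rewrite !inE => -[/andP[uE _] /andP[vE _]].
    by move: Av; rewrite -(Eor _ _ uE vE) Au.
  move: notboth; rewrite !andbT.
  case: ((u, v) \in _); case: ((v, u) \in _) => notboth; rewrite ?addr0 ?add0r //.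
  by case: notboth.
under eq_bigr do rewrite big_split /=; rewrite big_split /= [X in _ + X]exchange_big /=.
rewrite !(pair_bigA _ (fun u v => half (u, v) _)) /= -big_split /=.
rewrite /horizontal_cut [RHS]big_mkcond; apply: eq_bigr => -[u v] _; rewrite /half /=.
case: ((u, v) \in _) => /=; last by rewrite addr0.
by case: (A u); case: (A v); rewrite /= ?mulr0 ?mulr1 ?addr0 ?add0r.
Qed.

Lemma is_cutE (V : finType) (S T : {set flow_vertex V}) :
  is_cut S T -> [/\ T = ~: S, source V \in S & sink V \notin S].
Proof.
move=> [/setP ST /setP STI sS tT].
have TE : T = ~: S.
  apply/setP => a; move: (ST a) (STI a); rewrite !inE.
  by case: (a \in S) => //= _ ->.
by split=> //; rewrite -finset.in_setC -TE.
Qed.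

(** The booleans [a] and [b] say whether the copies 1 and 2 of [v] lie in S. When only copy 2 does,
    both outer edges are cut, and the middle edge runs from T to S at no cost. *)
Definition vertical_cut (R : realType) (V : finType) (E : {set V * V})
    (w : V * V -> R) (f : 'rV[R]_#|V| -> R) (g : V -> R -> \bar R)
    (x : 'rV[R]_#|V|) (v : V) (a b : bool) : \bar R :=
  ((if a then 0 else - delta_minus E w f g x v + middle_capacity E w f g x v)
   + (if a && ~~ b then middle_capacity E w f g x v else 0)
   + (if b then delta_plus E w f g x v + middle_capacity E w f g x v else 0))%E.

Definition layer_cut (R : realType) (V : finType) (E : {set V * V})
    (w : V * V -> R) (f : 'rV[R]_#|V| -> R) (g : V -> R -> \bar R)
    (x : 'rV[R]_#|V|) (A B : pred V) : \bar R :=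
  (\sum_v vertical_cut E w f g x v (A v) (B v)
   + (horizontal_cut E w x A + horizontal_cut E w x B)%:E)%E.

Lemma cut_value_layers (R : realType) (V : finType) (E : {set V * V})
    (w : V * V -> R) (f : 'rV[R]_#|V| -> R) (g : V -> R -> \bar R)
    (x : 'rV[R]_#|V|) (S T : {set flow_vertex V}) :
  oriented_once E -> is_cut S T ->
  cut_value E w f g x S T =
  layer_cut E w f g x (fun v => copy1 v \in S) (fun v => copy2 v \in S).
Proof.
move=> Eor /is_cutE[-> sS /negbTE tS].
(* Extending the summand by zero to all pairs of vertices allows splitting the sum by the kind of
   each endpoint. *)
pose F a b := if (((a, b) \in flow_edges E x) && ((a \in S) && (b \notin S)))
              then capacity E w f g x (a, b) else 0%E.
rewrite /cut_value big_mkcond /=; transitivity (\sum_a \sum_b F a b)%E.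
  rewrite pair_bigA /=; apply: eq_bigr => -[a b] _.
  by rewrite /F finset.in_setI finset.in_setX finset.in_setC.
pose h (k : bool) u v :=
  if (((u, v) \in tied_edges E x) || ((v, u) \in tied_edges E x))
     && ((layered k u \in S) && (layered k v \notin S))
  then w (if (u, v) \in tied_edges E x then (u, v) else (v, u)) else 0.
have Fh k u v : F (layered k u) (layered k v) = (h k u v)%:E.
  by rewrite /F /h mem_flow_edges; case: k => /=; rewrite orbF; case: ifP.
have F12 u v : F (copy1 u) (copy2 v) =
    if v == u then (if (copy1 u \in S) && (copy2 u \notin S)
                   then middle_capacity E w f g x u else 0%E) else 0%E.
  rewrite /F mem_flow_edges /= (eq_sym v); case: eqP => [->|//].
  by case: ifP.
have F21 u v : F (copy2 u) (copy1 v) = 0%E by rewrite /F mem_flow_edges.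
have Fs v : F (source V) (copy1 v) = if copy1 v \in S then 0%E else
      (- delta_minus E w f g x v + middle_capacity E w f g x v)%E.
  by rewrite /F mem_flow_edges sS /=; case: (copy1 v \in S).
have Fs2 v : F (source V) (copy2 v) = 0%E by rewrite /F mem_flow_edges.
have Ft v : F (copy2 v) (sink V) = if copy2 v \in S then
      (delta_plus E w f g x v + middle_capacity E w f g x v)%E else 0%E.
  by rewrite /F mem_flow_edges tS /= andbT.
have F1t v : F (copy1 v) (sink V) = 0%E by rewrite /F mem_flow_edges.
have F1s v : F (copy1 v) (source V) = 0%E by rewrite /F mem_flow_edges.
have F2s v : F (copy2 v) (source V) = 0%E by rewrite /F mem_flow_edges.
have Fss : F (source V) (source V) = 0%E by rewrite /F mem_flow_edges.
have Fst : F (source V) (sink V) = 0%E by rewrite /F mem_flow_edges.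
have Ft0 : (\sum_a F (sink V) a = 0)%E.
  by apply: big1 => a _; rewrite /F tS andbF.
rewrite sum_flow_vertex (sum_flow_vertex (F (source V))) Ft0.
rewrite Fss Fst !adde0.
transitivity (\sum_u ((\sum_v (h false u v)%:E
     + (if (copy1 u \in S) && (copy2 u \notin S)
        then middle_capacity E w f g x u else 0))
    + (\sum_v (h true u v)%:E + F (copy2 u) (sink V)))
   + \sum_u F (source V) (copy1 u))%E.
  congr (_ + _)%E; apply: eq_bigr => u _; last by rewrite Fs2 adde0.
  rewrite !sum_flow_vertex F1s F1t F2s !(add0e, adde0); congr (_ + (_ + _))%E.
    rewrite big_split /=; congr (_ + _)%E; first by apply: eq_bigr => v _; exact: Fh.
    by under eq_bigr do rewrite F12; rewrite -big_mkcond big_pred1_eq.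
  by apply: eq_bigr => v _; rewrite F21 add0e; exact: Fh.
rewrite /layer_cut EFinD -!(sum_horizontal_edges w x _ Eor).
have hE k : ((\sum_u \sum_v h k u v)%:E = \sum_u \sum_v (h k u v)%:E)%E.
  by rewrite -sumEFin; apply: eq_bigr => u _; rewrite -sumEFin.
have := hE false; rewrite /h => ->; have := hE true; rewrite /h => ->.
rewrite -!big_split /=; apply: eq_bigr => u _.
rewrite /vertical_cut Fs Ft.
have regroup (a b c d e : \bar R) : (a + b + (c + d) + e = e + b + d + (a + c))%E.
  by rewrite (addeACA a) (addeC (a + c)%E) (addeC _ e) !addeA.
exact: regroup.
Qed.

(** * Nonnegative capacities and submodularity *)

(** The middle capacity dominates [delta_minus] and [- delta_plus]. Both are below +oo because the
    directional derivatives are not -oo, so it is finite, and the outer capacities are meaningful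
    differences even if a delta is infinite. *)
Lemma capacities_ge0 (R : realType) (V : finType) (E : {set V * V})
    (w : V * V -> R) (f : 'rV[R]_#|V| -> R) (g : V -> R -> \bar R)
    (x : 'rV[R]_#|V|) (v : V) :
  dirder (g v) (vcoord x v) 1 != -oo%E -> dirder (g v) (vcoord x v) (-1) != -oo%E ->
  [/\ middle_capacity E w f g x v \is a fin_num,
      (0 <= middle_capacity E w f g x v)%E,
      (0 <= - delta_minus E w f g x v + middle_capacity E w f g x v)%E
    & (0 <= delta_plus E w f g x v + middle_capacity E w f g x v)%E].
Proof.
move=> plusNy minusNy; set m := middle_capacity E w f g x v.
have m0 : (0 <= m)%E by rewrite le_max lexx.
have mminus : (delta_minus E w f g x v <= m)%E by rewrite !le_max lexx !orbT.
have mplus : (- delta_plus E w f g x v <= m)%E by rewrite !le_max lexx !orbT.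
have minus_y : (delta_minus E w f g x v < +oo)%E.
  by rewrite /delta_minus; case: (dirder _ _ (-1)) minusNy => //= r _; rewrite ltry.
have plus_Ny : (- delta_plus E w f g x v < +oo)%E.
  by rewrite /delta_plus; case: (dirder _ _ 1) plusNy => //= r _; rewrite ltry.
have mfin : m \is a fin_num by rewrite ge0_fin_numE// /m /middle_capacity !gt_max ltry minus_y.
split=> //; first by rewrite addeC sube_ge0 ?mfin ?orbT.
by rewrite addeC -[X in (_ + X)%E]oppeK sube_ge0 ?mfin ?orbT.
Qed.

(* Neither replacement, (A u B, B) or (A, A n B), need be cheaper than (A, B)
   by itself when some delta_v^+ < delta_v^-; the submodularity of the horizontal
   cut only bounds their sum. *)
Lemma layer_cut_normalize (R : realType) (V : finType) (E : {set V * V})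
    (w : V * V -> R) (f : 'rV[R]_#|V| -> R) (g : V -> R -> \bar R)
    (x : 'rV[R]_#|V|) (A B : pred V) :
  (forall e, e \in E -> 0 <= w e) ->
  (forall v, dirder (g v) (vcoord x v) 1 != -oo%E) ->
  (forall v, dirder (g v) (vcoord x v) (-1) != -oo%E) ->
  (layer_cut E w f g x (predU A B) B + layer_cut E w f g x A (predI A B)
   <= layer_cut E w f g x A B + layer_cut E w f g x A B)%E.
Proof.
move=> w0 gp gm; rewrite /layer_cut.
have hAB : horizontal_cut E w x (predU A B) + horizontal_cut E w x (predI A B)
    <= horizontal_cut E w x A + horizontal_cut E w x B.
  rewrite /horizontal_cut -!big_split /=; apply: ler_sum => e.
  rewrite inE => /andP[/w0 we _]; rewrite -!mulrDr ler_wpM2l// -!natrD ler_nat.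
  by case: (A e.1); case: (A e.2); case: (B e.1); case: (B e.2).
rewrite addeACA [leRHS]addeACA -!EFinD; apply: leeD; last by rewrite lee_fin; lra.
(* The vertical cost changes only at [v] in B outside A, which pays both outer capacities: the first
   replacement keeps only the sink edge, the second only the source edge. *)
by apply: leeD; apply: lee_sum => v _ /=; rewrite /vertical_cut;
  have [_ m0 c1 c3] := capacities_ge0 E w f (gp v) (gm v);
  case: (A v); case: (B v); rewrite /= ?adde0 ?add0e// ?leeDl ?leeDr.
Qed.

(** * Nested layers and ternary directions *)

Definition layer_direction (R : realType) (V : finType) (A B : pred V) : 'rV[R]_#|V| :=
  vec (fun v => if B v then 1 else if A v then 0 else -1).

Lemma vcoord_vec (R : realType) (V : finType) (a : V -> R) (v : V) :
  vcoord (vec a) v = a v.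
Proof. by rewrite /vcoord mxE enum_rankK. Qed.

Lemma has_dirder_dir0 (R : realType) (h : R -> \bar R) (x : R) :
  h x \is a fin_num -> has_dirder h x 0 0%E.
Proof.
move=> hx; split=> //; rewrite /diff_quotient.
under eq_fun do rewrite scaler0 addr0 subee// mul0e.
exact: cvg_cst.
Qed.

(** For nested sets, 1_A u - 1_A v and 1_B u - 1_B v never have opposite signs, so the absolute
    value of their sum is the sum of their absolute values. *)
Lemma horizontal_cut_direction (R : realType) (V : finType) (E : {set V * V})
    (w : V * V -> R) (x : 'rV[R]_#|V|) (A B : pred V) :
  (forall v, B v -> A v) ->
  \sum_(e in tied_edges E x) w e * `|vcoord (layer_direction R A B) e.1
                                     - vcoord (layer_direction R A B) e.2| =
  horizontal_cut E w x A + horizontal_cut E w x B.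
Proof.
move=> BA; rewrite /horizontal_cut -big_split /=; apply: eq_bigr => e _.
rewrite !vcoord_vec -mulrDr; congr (_ * _).
have := BA e.1; have := BA e.2.
case: (A e.1); case: (A e.2); case: (B e.1); case: (B e.2) => //= H1 H2;
  do ?[by have := H1 isT | by have := H2 isT];
  by rewrite ?opprK -?opprD ?subrr ?subr0 ?sub0r ?add0r ?addr0 ?addNr
             ?normrN ?normr0 ?normr1 ?(normr_nat _ 2) -?natrD.
Qed.

Lemma dirder_layer_direction (R : realType) (V : finType) (E : {set V * V})
    (w : V * V -> R) (f : 'rV[R]_#|V| -> R) (g : V -> R -> \bar R)
    (x : 'rV[R]_#|V|) (A B : pred V) :
  differentiable f x ->
  (forall (v : V) (y : R), g v y != -oo%E) ->
  (forall v : V, directionally_differentiable (g v)) ->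
  edom (objective E w f g) x ->
  (forall v, B v -> A v) ->
  (dirder (objective E w f g) x (layer_direction R A B)
   + \sum_v middle_capacity E w f g x v)%E = layer_cut E w f g x A B.
Proof.
move=> fx gNy gdir xdom BA.
rewrite (has_dirder_dirder (has_dirder_objective _ fx gNy gdir xdom)).
rewrite (derive_partial _ fx) sum_norm_dirder horizontal_cut_direction//.
rewrite /layer_cut [(_ + (_ + _))%:E]EFinD addeA [LHS]addeAC; congr (_ + _)%E.
(* The horizontal terms have been matched. At each vertex exactly one vertical edge is cut, at cost
   [delta_plus], 0 or [- delta_minus] plus the middle capacity, for d_v = 1, 0 or -1. *)
rewrite -!sumEFin -!big_split /=; apply: eq_bigr => v _.
rewrite vcoord_vec /vertical_cut; have := BA v.
case: (B v) => [->//|_]; [|case: (A v)] => /=.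
- by rewrite !mul1r !add0e.
- rewrite (has_dirder_dirder (has_dirder_dir0 (edom_objective gNy xdom v))).
  by rewrite !mul0r !adde0.
- rewrite !mulN1r !adde0 /delta_minus; congr (_ + _)%E.
  have /admits_dirderP[l] : admits_dirder (g v) (vcoord x v) (-1).
    by apply: gdir; rewrite /edom ltey_eq (edom_objective gNy xdom).
  move=> hl; rewrite (has_dirder_dirder hl); case: hl => + _.
  (* The derivative in direction -1 may be +oo, so the opposite of the sum is computed by cases. *)
  case: l => [r _|//|//] /=.
  by rewrite -[LHS]/((- partial_der f v x + r - sign_sum E w x v)%:E); congr EFin; ring.
Qed.

Lemma layer_cut_ge0 (R : realType) (V : finType) (E : {set V * V})
    (w : V * V -> R) (f : 'rV[R]_#|V| -> R) (g : V -> R -> \bar R)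
    (x : 'rV[R]_#|V|) (A B : pred V) :
  (forall e, e \in E -> 0 <= w e) ->
  (forall v, dirder (g v) (vcoord x v) 1 != -oo%E) ->
  (forall v, dirder (g v) (vcoord x v) (-1) != -oo%E) ->
  (0 <= layer_cut E w f g x A B)%E.
Proof.
move=> w0 gp gm; rewrite /layer_cut adde_ge0//.
  apply: sume_ge0 => v _; have [_ m0 c1 c3] := capacities_ge0 E w f (gp v) (gm v).
  by rewrite /vertical_cut; case: (A v); case: (B v); rewrite /= ?adde0 ?add0e// adde_ge0.
by rewrite lee_fin addr_ge0// sumr_ge0// => e;
  rewrite inE => /andP[/w0 we _]; rewrite mulr_ge0.
Qed.

(** This is the cut of the zero direction; it bounds the minimum cut by a finite value. *)
Lemma layer_cut_middle (R : realType) (V : finType) (E : {set V * V})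
    (w : V * V -> R) (f : 'rV[R]_#|V| -> R) (g : V -> R -> \bar R)
    (x : 'rV[R]_#|V|) :
  layer_cut E w f g x predT pred0 = (\sum_v middle_capacity E w f g x v)%E.
Proof.
have horizontal0 b : horizontal_cut E w x (fun=> b) = 0.
  by rewrite /horizontal_cut big1// => e _; rewrite eqxx mulr0.
rewrite /layer_cut [horizontal_cut E w x _]horizontal0 [horizontal_cut E w x _]horizontal0.
rewrite addr0 adde0.
by apply: eq_bigr => v _; rewrite /vertical_cut /= add0e adde0.
Qed.

(** * Realising layers by cuts, and directions by layers *)

Definition layer_set (V : finType) (A B : pred V) : {set flow_vertex V} :=
  [set a : flow_vertex V | match a with
                           | inl (v, k) => if k then B v else A v
                           | inr b => ~~ b
                           end].

Lemma is_cut_setC (V : finType) (S : {set flow_vertex V}) :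
  source V \in S -> sink V \notin S -> is_cut S (~: S).
Proof.
by move=> sS tS; split; rewrite ?finset.setUCr ?finset.setICr// finset.in_setC.
Qed.

Lemma cut_value_layer_set (R : realType) (V : finType) (E : {set V * V})
    (w : V * V -> R) (f : 'rV[R]_#|V| -> R) (g : V -> R -> \bar R)
    (x : 'rV[R]_#|V|) (A B : pred V) :
  oriented_once E ->
  is_cut (layer_set A B) (~: layer_set A B) /\
  cut_value E w f g x (layer_set A B) (~: layer_set A B) = layer_cut E w f g x A B.
Proof.
move=> Eor; have cutAB : is_cut (layer_set A B) (~: layer_set A B).
  by apply: is_cut_setC; rewrite inE.
split=> //; rewrite cut_value_layers//.
by congr layer_cut; apply/funext => v; rewrite inE.
Qed.

Lemma exists_min_cut (R : realType) (V : finType) (E : {set V * V})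
    (w : V * V -> R) (f : 'rV[R]_#|V| -> R) (g : V -> R -> \bar R)
    (x : 'rV[R]_#|V|) :
  exists S T : {set flow_vertex V}, is_min_cut E w f g x S T.
Proof.
pose P (S : {set flow_vertex V}) := (source V \in S) && (sink V \notin S).
have P0 : P [set source V] by rewrite /P !inE eqxx.
(* T is the complement of S, so minimising over the finitely many admissible S suffices. *)
case: (arg_minP (fun S => cut_value E w f g x S (~: S)) P0) => S /andP[sS tS] Smin.
exists S, (~: S); split; first exact: is_cut_setC.
by move=> S' T' /is_cutE[-> sS' tS']; apply: Smin; rewrite /P sS'.
Qed.

(** The layers are the superlevel sets d >= 0 and d >= 1, which are nested. *)
Lemma ternary_layer_direction (R : realType) (V : finType) (d : 'rV[R]_#|V|) :
  ternary d ->
  d = layer_direction R (fun v => vcoord d v != -1) (fun v => vcoord d v == 1).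
Proof.
move=> dter; apply/rowP => i; rewrite mxE; have := dter (enum_val i).
have -> : d ord0 i = vcoord d (enum_val i) by rewrite /vcoord enum_valK.
move: (vcoord d _) => c; rewrite !inE.
have [->|c1] := eqVneq c 1; first by [].
by have [->|_] := eqVneq c (-1); rewrite //= orbF => /eqP.
Qed.

Lemma is_min_cut_layers (R : realType) (V : finType) (E : {set V * V})
    (w : V * V -> R) (f : 'rV[R]_#|V| -> R) (g : V -> R -> \bar R)
    (x : 'rV[R]_#|V|) (S T : {set flow_vertex V}) (A B : pred V) :
  oriented_once E -> is_min_cut E w f g x S T ->
  (layer_cut E w f g x (fun v => copy1 v \in S) (fun v => copy2 v \in S)
   <= layer_cut E w f g x A B)%E.
Proof.
move=> Eor [cutST minST]; rewrite -(cut_value_layers _ _ _ _ Eor cutST).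
have [cutAB <-] := cut_value_layer_set w f g x A B Eor.
exact: minST.
Qed.

(** * From minimum cuts to steepest ternary directions *)

Theorem proposition2p3 (R : realType) (V : finType) (E : {set V * V})
    (w : V * V -> R) (f : 'rV[R]_#|V| -> R) (g : V -> R -> \bar R)
    (x : 'rV[R]_#|V|)
    (E_oriented : oriented_once E)
    (w_ge0 : forall e : V * V, e \in E -> 0 <= w e)
    (f_diff : forall y : 'rV[R]_#|V|, differentiable f y)
    (g_gtNy : forall (v : V) (y : R), g v y != -oo%E)
    (g_dirdiff : forall v : V, directionally_differentiable (g v))
    (x_dom : edom (objective E w f g) x) :
  [/\ directionally_differentiable (objective E w f g),
      exists S T : {set flow_vertex V}, is_min_cut E w f g x S T
    & forall S T : {set flow_vertex V}, is_min_cut E w f g x S T ->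
        steepest_ternary_direction (objective E w f g) x (cut_direction R S)].
Proof.
split; [|exact: exists_min_cut|].
  move=> y d y_dom; apply/admits_dirderP; eexists.
  exact: has_dirder_objective.
move=> S T minST.
set A : pred V := fun v => copy1 v \in S; set B : pred V := fun v => copy2 v \in S.
have gNy v d : dirder (g v) (vcoord x v) d != -oo%E.
  have /admits_dirderP[l hl] : admits_dirder (g v) (vcoord x v) d.
    by apply: g_dirdiff; rewrite /edom ltey_eq (edom_objective g_gtNy x_dom).
  by rewrite (has_dirder_dirder hl); case: hl.
have layers_min A' B' : (layer_cut E w f g x A B <= layer_cut E w f g x A' B')%E.
  exact: is_min_cut_layers minST.
have middle_fin : (\sum_v middle_capacity E w f g x v)%E \is a fin_num.
  by apply/sum_fin_numP => v _ _; have [] := capacities_ge0 E w f (gNy v 1) (gNy v (-1)).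
(* Finiteness of the minimum is what permits cancelling it in an inequality of extended reals. *)
have cut_fin : layer_cut E w f g x A B \is a fin_num.
  rewrite ge0_fin_numE ?layer_cut_ge0//.
  by rewrite (le_lt_trans (layers_min predT pred0))// layer_cut_middle ltey_eq middle_fin.
(* Minimality bounds the cut of (A, B) by that of its other replacement (A, A n B); inserting this
   in the submodular inequality and cancelling leaves the claim. *)
have normalized_min : (layer_cut E w f g x (predU A B) B <= layer_cut E w f g x A B)%E.
  rewrite -(leeD2rE _ _ cut_fin).
  apply: le_trans (layer_cut_normalize _ _ _ w_ge0 _ _) => //.
  exact: leeD2l.
split=> [v|d' /ternary_layer_direction ->].
  by rewrite vcoord_vec !inE; case: ifP => _; [|case: ifP => _]; rewrite eqxx ?orbT.
(* Copy 2 is tested first, so adding B to A does not alter the direction. *)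
have -> : cut_direction R S = layer_direction R (predU A B) B.
  apply/rowP => i; rewrite !mxE /= -/(A _) -/(B _).
  by case: (B _); rewrite ?orbF.
(* Adding the finite sum of middle capacities turns both derivatives into cuts of nested layers. *)
rewrite -(leeD2rE _ _ middle_fin) !dirder_layer_direction//.
- exact: le_trans normalized_min (layers_min _ _).
- by move=> v /eqP ->; rewrite -subr_eq0 opprK (pnatr_eq0 _ 2).
- by move=> v Bv /=; rewrite Bv orbT.
Qed.
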